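(* Let $\mathcal{H}$ be an $n$-dimensional Hilbert space, let $(W,w)=\{(W_i,\omega_i)\}_{i\in I_m}$ be a fusion frame for $\mathcal{H}$ with fusion frame operator $S_W$, let $\{e_j\}_{j\in I_n}$ be an orthonormal basis of $\mathcal{H}$, and let $F:=\{\omega_i\pi_{W_i}S_W^{-1}e_j\}_{j\in I_n,\,i\in I_m}$. Then the following assertions hold. (1) Let $(V,v)=\{(V_i,\nu_i)\}_{i\in I_m}$ be a fusion frame for $\mathcal{H}$ such that $G:=\{\nu_i\pi_{V_i}e_j\}_{j\in I_n,\,i\in I_m}$ is a dual frame of $F$ which, for every $i\in I_m$, is a partial optimal dual frame of $F$ for the erasure of the $n$ elements $\{\omega_i\pi_{W_i}S_W^{-1}e_j\}_{j\in I_n}$ of $F$. Then $(V,v)$ is a $1$-loss optimal dual fusion frame of $(W,w)$. (2) If $(W,w)$ is a Riesz fusion basis, then every dual frame of $F$ is a partial optimal dual frame of $F$ for $n$-erasures.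
   Context: $I_m=\{1,\dots,m\}$; $\pi_X$ is the orthogonal projection onto a subspace $X$; $\|\cdot\|_F$ is the Frobenius norm. Fusion frames: a family $(W,w)=\{(W_i,\omega_i)\}_{i\in I_m}$ of subspaces $W_i$ of the finite-dimensional Hilbert space $\mathcal{H}$ with weights $\omega_i>0$ is a fusion frame if $\operatorname{span}\bigcup_i W_i=\mathcal{H}$. Its fusion frame operator is $S_W f=\sum_{i\in I_m}\omega_i^2\pi_{W_i}f$, which is positive and invertible. Fusion frames are assumed non-trivial, i.e. $W_i\ne\mathcal{H}$ for at least one $i$. A family $\{(W_i,\omega_i)\}_{i\in I_m}$ is a Riesz fusion basis if it is complete (the subspaces span $\mathcal{H}$) and there are constants $0<A\le B$ with $A\sum_{i\in J}\|f_i\|^2\le\|\sum_{i\in J}f_i\|^2\le B\sum_{i\in J}\|f_i\|^2$ for all finite $J\subset I_m$ and $f_i\in W_i$. Dual fusion frames: a family $(V,v)=\{(V_i,\nu_i)\}_{i\in I_m}$ of subspaces with weights $\nu_i>0$ is a dual fusion frame of $(W,w)$ if $\sum_{i\in I_m}\omega_i\nu_i\pi_{V_i}S_W^{-1}\pi_{W_i}=I_{\mathcal{H}}$; the set of these is $D_W$. $(V,v)\in D_W$ is a $1$-loss optimal dual fusion frame of $(W,w)$ if $$\max_{i\in I_m}\|\omega_i\nu_i\pi_{V_i}S_W^{-1}\pi_{W_i}\|_F=\inf\Big\{\max_{i\in I_m}\|\omega_iz_i\pi_{Z_i}S_W^{-1}\pi_{W_i}\|_F:(Z,z)\in D_W\Big\}.$$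 Discrete frames: a finite family $F=\{f_k\}_{k\in K}$ spanning $\mathcal{H}$ is a frame; $\theta_F\{c_k\}=\sum_k c_kf_k$ and $\theta_F^*f=\{\langle f,f_k\rangle\}_k$. $G=\{g_k\}_{k\in K}$ is a dual (frame) of $F$ if $\theta_G\theta_F^*=I_{\mathcal{H}}$; $D_F$ denotes the set of duals. For $\Lambda\subset K$ let $D_\Lambda$ be the diagonal operator with diagonal entries $1$ at indices in $\Lambda$ and $0$ otherwise. A dual $G$ of $F$ is a partial optimal dual for the erasure of $\{f_k\}_{k\in\Lambda}$ if $\|\theta_GD_\Lambda\theta_F^*\|_F=\inf\{\|\theta_XD_\Lambda\theta_F^*\|_F:X\in D_F\}$; it is a partial optimal dual of $F$ for $r$-erasures if this holds for some $\Lambda$ with $|\Lambda|=r$. *)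

(* Defs.v *)
From HB Require Import structures.
From mathcomp Require Import all_boot all_order all_algebra.
From mathcomp Require Import boolp classical_sets reals.
From mathcomp Require Import complex.

Set Implicit Arguments.
Unset Strict Implicit.
Unset Printing Implicit Defensive.

Import Order.TTheory GRing.Theory Num.Theory.
Local Open Scope ring_scope.

(** * Scalars: the real or the complex numbers *)

Variant scalar_kind := RealScalars | ComplexScalars.

Section Scalars.
Variable R : realType.

Definition scal_field (s : scalar_kind) : numFieldType :=
  match s with RealScalars => R | ComplexScalars => R[i] end.

Definition scal_conj (s : scalar_kind) :
    {rmorphism scal_field s -> scal_field s} :=
  match s with
  | RealScalars => [the {rmorphism R -> R} of @idfun R]
  | ComplexScalars => [the {rmorphism R[i] -> R[i]} of @conjc R]
  end.

Definition ofreal (s : scalar_kind) : {rmorphism R -> scal_field s} :=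
  match s with
  | RealScalars => [the {rmorphism R -> R} of @idfun R]
  | ComplexScalars => [the {rmorphism R -> R[i]} of (fun x : R => x%:C%C)]
  end.

Definition realpart (s : scalar_kind) : scal_field s -> R :=
  match s with
  | RealScalars => fun x => x
  | ComplexScalars => @complex.Re R
  end.

Lemma conj_ofreal s (x : R) : scal_conj s (ofreal s x) = ofreal s x.
Proof. by case: s => //=; rewrite /conjc oppr0. Qed.

Lemma conjK s : involutive (scal_conj s).
Proof. by case: s => [x|x] //=; exact: conjcK. Qed.

Lemma ofrealK s : cancel (ofreal s) (@realpart s).
Proof. by case: s. Qed.

Lemma realpartK s (z : scal_field s) : 0 <= z -> ofreal s (realpart z) = z.
Proof. by case: s z => //= -[a b]; rewrite lecE /= => /andP[/eqP-> _]. Qed.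

End Scalars.

Arguments scal_conj {R s}.
Arguments ofreal {R s}.
Arguments realpart {R s}.

(** * Finite-dimensional Hilbert spaces *)

Section Hilbert.
Variables (R : realType) (s : scalar_kind).
Local Notation K := (scal_field R s).
Variables (H : vectType K) (ip : {dot H for @scal_conj R s}).

(* [ip] is linear in its first argument and conjugate linear in the second. *)
Local Notation "''[' u , v ]" := (ip u v).

Definition hnorm (u : H) : R := Num.sqrt (realpart '[u, u]).

Definition is_onb (b : seq H) : bool :=
  basis_of fullv b && orthonormal ip b.

(* The projection onto [U] along the orthogonal complement of [U]; see
   [proj_mem] and [sub_proj_orthov]. *)
Definition proj (U : {vspace H}) : 'End(H) := daddv_pi U (orthov ip U).

(* The Frobenius norm, (tr (T^* T))^(1/2).  It does not depend on the chosen
   orthonormal basis (lemma [frobE]), and such a basis exists (lemma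
   [exists_onb]). *)
Definition frob (T : 'End(H)) : R :=
  xget 0 [set x : R | exists2 b : seq H,
    is_onb b & x = Num.sqrt (\sum_(u <- b) hnorm (T u) ^+ 2)]%classic.

(** * Discrete frames *)

Section DiscreteFrames.
Variable I : finType.
Implicit Types (F G X : I -> H) (L : {set I}) (c : {ffun I -> K^o}).

Definition synthesis_fun F c : H := \sum_k (c k : K) *: F k.

Definition analysis_fun F (f : H) : {ffun I -> K^o} := [ffun k => '[f, F k]].

Definition coord_proj_fun L c : {ffun I -> K^o} :=
  [ffun k => if k \in L then c k else 0].

Fact synthesis_is_linear F : linear (synthesis_fun F).
Proof.
move=> a c d; rewrite /synthesis_fun scaler_sumr -big_split /=.
by apply: eq_bigr => k _; rewrite !ffunE scalerDl scalerA.
Qed.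
HB.instance Definition _ F :=
  GRing.isLinear.Build _ _ _ _ (synthesis_fun F) (synthesis_is_linear F).

Fact analysis_is_linear F : linear (analysis_fun F).
Proof.
by move=> a f g; apply/ffunP => k; rewrite !ffunE linearPl.
Qed.
HB.instance Definition _ F :=
  GRing.isLinear.Build _ _ _ _ (analysis_fun F) (analysis_is_linear F).

Fact coord_proj_is_linear L : linear (coord_proj_fun L).
Proof.
move=> a c d; apply/ffunP => k; rewrite !ffunE.
by case: ifP => // _; rewrite scaler0 addr0.
Qed.
HB.instance Definition _ L :=
  GRing.isLinear.Build _ _ _ _ (coord_proj_fun L) (coord_proj_is_linear L).

Definition synthesis F : 'Hom({ffun I -> K^o}, H) := linfun (synthesis_fun F).
Definition analysis F : 'Hom(H, {ffun I -> K^o}) := linfun (analysis_fun F).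
Definition coord_proj L : 'End({ffun I -> K^o}) := linfun (coord_proj_fun L).

Lemma synthesisE F c : synthesis F c = \sum_k (c k : K) *: F k.
Proof. by rewrite lfunE. Qed.

Lemma analysisE F f k : analysis F f k = '[f, F k].
Proof. by rewrite lfunE /= ffunE. Qed.

Lemma coord_projE L c k : coord_proj L c k = if k \in L then c k else 0.
Proof. by rewrite lfunE /= ffunE. Qed.

(* If [F] has a dual then both [F] and the dual span [H]. *)
Definition dual_frames F : set (I -> H) :=
  [set G | (synthesis G \o analysis F)%VF = \1%VF]%classic.

Definition erasure_op F L G : 'End(H) :=
  (synthesis G \o coord_proj L \o analysis F)%VF.

Definition partial_optimal_dual_for F L G : Prop :=
  dual_frames F G /\
  frob (erasure_op F L G) =
    inf [set frob (erasure_op F L X) | X in dual_frames F]%classic.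

Definition partial_optimal_dual F (r : nat) G : Prop :=
  exists L : {set I}, #|L| = r /\ partial_optimal_dual_for F L G.

End DiscreteFrames.

(** * Fusion frames *)

Section FusionFrames.
Variable m : nat.
Implicit Types (W V : 'I_m -> {vspace H}) (w v : 'I_m -> R).

Definition fusion_frame W w : Prop :=
  [/\ forall i, 0 < w i,
      (\sum_i W i)%VS = fullv
    & exists i, W i != fullv].

Definition fusion_op W w : 'End(H) := \sum_i ofreal (w i ^+ 2) *: proj (W i).

Definition riesz_fusion_basis W : Prop :=
  (\sum_i W i)%VS = fullv /\
  exists A B : R, [/\ 0 < A, A <= B
    & forall (J : {set 'I_m}) (f : 'I_m -> H),
        (forall i, i \in J -> f i \in W i) ->
        A * \sum_(i in J) hnorm (f i) ^+ 2 <= hnorm (\sum_(i in J) f i) ^+ 2 /\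
        hnorm (\sum_(i in J) f i) ^+ 2 <= B * \sum_(i in J) hnorm (f i) ^+ 2].

(* omega_i nu_i pi_{V_i} S_W^{-1} pi_{W_i}.  The operator [^-1] of 'End(H) is
   the two-sided inverse here, because the fusion frame operator of a fusion
   frame is bijective. *)
Definition fusion_term W w V v (i : 'I_m) : 'End(H) :=
  ofreal (w i * v i) *:
    (proj (V i) \o (fusion_op W w)^-1 \o proj (W i))%VF.

(* Pairs (subspaces, weights).  Neither completeness nor non-triviality of
   [Vv] is asked for; completeness follows from the identity. *)
Definition dual_fusion_frames W w :
    set (('I_m -> {vspace H}) * ('I_m -> R)) :=
  [set Vv | (forall i, 0 < Vv.2 i) /\
            \sum_i fusion_term W w Vv.1 Vv.2 i = \1%VF]%classic.

(* The base value 0 of the maximum is harmless: Frobenius norms are >= 0. *)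
Definition one_loss W w V v : R :=
  \big[Num.max/0]_(i < m) frob (fusion_term W w V v i).

Definition one_loss_optimal W w V v : Prop :=
  dual_fusion_frames W w (V, v) /\
  one_loss W w V v =
    inf [set one_loss W w Zz.1 Zz.2 | Zz in dual_fusion_frames W w]%classic.

End FusionFrames.
End Hilbert.

(** * The definitions above are well behaved *)

Section Facts.
Variables (R : realType) (s : scalar_kind).
Local Notation K := (scal_field R s).
Variables (H : vectType K) (ip : {dot H for @scal_conj R s}).
Local Notation "''[' u , v ]" := (ip u v).
Local Notation hnorm := (hnorm ip).
Implicit Types (U : {vspace H}) (b c : seq H) (T : 'End(H)).

Lemma ipC u v : '[u, v] = scal_conj '[v, u].
Proof. by rewrite (hermC ip) expr0 mul1r. Qed.

Lemma ip_gt0 u : u != 0 -> 0 < '[u, u].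
Proof. exact: neq0_dnorm_gt0. Qed.

Lemma ip_ge0 u : 0 <= '[u, u].
Proof. by have [->|/ip_gt0/ltW //] := eqVneq u 0; rewrite linear0l. Qed.

Lemma ip_eq0 u : '[u, u] = 0 -> u = 0.
Proof. by have [->//|/ip_gt0/[swap]->] := eqVneq u 0; rewrite ltxx. Qed.

Lemma realpart_ge0 (z : K) : 0 <= z -> 0 <= realpart z.
Proof. by case: s z => //= -[a b']; rewrite lecE /= => /andP[]. Qed.

Lemma hnormE u : ofreal (hnorm u ^+ 2) = '[u, u].
Proof.
by rewrite sqr_sqrtr ?realpart_ge0 ?ip_ge0// realpartK ?ip_ge0.
Qed.

Lemma orthov_cap U : (U :&: orthov ip U)%VS = 0%VS.
Proof.
apply/eqP; rewrite -subv0; apply/subvP => u /memv_capP[uU /mem_orthovP uo].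
by rewrite (ip_eq0 (uo u uU)) mem0v.
Qed.

Lemma dim_orthov U : (\dim {:H} <= \dim U + \dim (orthov ip U))%N.
Proof.
pose L := analysis ip (fun i : 'I_(\dim U) => (vbasis U)`_i).
have -> : orthov ip U = lker L.
  apply/vspaceP => u; rewrite memv_ker; apply/mem_orthovP/eqP => [uo|Lu v vU].
    apply/ffunP => i; rewrite analysisE ffunE uo//.
    by rewrite vbasis_mem// mem_nth// size_tuple.
  rewrite (coord_vbasis vU) (linear_sumr ip) big1// => i _.
  have /ffunP/(_ i) := Lu; rewrite analysisE ffunE => uU.
  by rewrite linearZr_LR/= uU mulr0.
rewrite -(limg_ker_dim L {:H}) capfv addnC leq_add2r.
apply: leq_trans (dimvS (subvf _)) _.
by rewrite dimvf /dim /= muln1 card_ord.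
Qed.

Lemma addv_orthov U : (U + orthov ip U)%VS = fullv.
Proof.
apply/eqP; rewrite eqEdim subvf /= dimv_disjoint_sum ?orthov_cap//.
exact: dim_orthov.
Qed.

Lemma proj_mem U u : proj ip U u \in U.
Proof. exact: memv_pi. Qed.

Lemma sub_proj_orthov U u : u - proj ip U u \in orthov ip U.
Proof.
have {1}<- := @daddv_pi_add _ _ U (orthov ip U) u (orthov_cap U); last first.
  by rewrite addv_orthov memvf.
by rewrite addrC addKr memv_pi.
Qed.

Lemma orthonormal_expand b u : orthonormal ip b -> u \in <<b>>%VS ->
  u = \sum_(v <- b) '[u, v] *: v.
Proof.
move=> ob; have E v : v \in b -> v = \sum_(x <- b) '[v, x] *: x.
  elim: b ob v => [//|a b IHb]; rewrite /orthonormal /= andbT.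
  move=> /andP[/andP[/eqP aa b1] /andP[/allP /= ab ob]] v.
  rewrite inE big_cons => /predU1P[->|vb].
    by rewrite aa scale1r big_seq big1 ?addr0// => x /ab/eqP->; rewrite scale0r.
  rewrite ipC (eqP (ab v vb)) rmorph0 scale0r add0r.
  by apply: IHb => //; rewrite /orthonormal b1.
move=> /(@coord_span _ _ _ (in_tuple b)) ->.
under [RHS]eq_bigr do rewrite linear_sumlz scaler_suml.
rewrite exchange_big; apply: eq_bigr => i _ /=.
rewrite {1}(E b`_i) ?mem_nth// scaler_sumr; apply: eq_bigr => v _.
by rewrite linearZl_LR scalerA.
Qed.

Lemma onb_expand b u : is_onb ip b -> u = \sum_(v <- b) '[u, v] *: v.
Proof.
by move=> /andP[/span_basis bf ob]; apply: orthonormal_expand; rewrite ?bf ?memvf.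
Qed.

Lemma frob_subproof b c T : is_onb ip b -> is_onb ip c ->
  \sum_(u <- c) hnorm (T u) ^+ 2 = \sum_(v <- b) hnorm (T v) ^+ 2.
Proof.
move=> ob oc; apply: (can_inj (@ofrealK R s)); rewrite !rmorph_sum /=.
under eq_bigr do rewrite hnormE; under [RHS]eq_bigr do rewrite hnormE.
under eq_bigr => u _.
  rewrite {1}(onb_expand u ob) linear_sum linear_sumlz.
  under eq_bigr do rewrite linearZ linearZl_LR /=.
  over.
rewrite exchange_big; apply: eq_bigr => v _ /=.
rewrite [X in _ = '[_, T X]](onb_expand v oc) linear_sum linear_sumr /=.
by apply: eq_bigr => u _; rewrite linearZ linearZr_LR /= -ipC.
Qed.

Lemma frobE b T : is_onb ip b ->
  frob ip T = Num.sqrt (\sum_(u <- b) hnorm (T u) ^+ 2).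
Proof.
move=> ob; rewrite /frob; case: xgetP => [_ -> [c oc ->]|/(_ _)].
  by rewrite (frob_subproof T ob oc).
by move=> /(_ (Num.sqrt (\sum_(u <- b) hnorm (T u) ^+ 2)))[]; exists b.
Qed.

Lemma exists_onb : exists b, is_onb ip b.
Proof.
suff: forall k, (k <= \dim {:H})%N ->
    exists b, [/\ size b = k, free b & orthonormal ip b].
  move=> /(_ _ (leqnn _))[b [sb fb ob]]; exists b.
  by rewrite /is_onb ob basisEfree fb subvf sb leqnn.
elim=> [_|k IHk kd]; first by exists [::]; rewrite nil_free.
have [b [sb fb ob]] := IHk (ltnW kd).
have [u uo u0] : exists2 u, u \in orthov ip <<b>>%VS & u != 0.
  exists (vpick (orthov ip <<b>>)); first exact: memv_pick.
  rewrite vpick0 -dimv_eq0 -lt0n -(ltn_add2l (\dim <<b>>)) addn0.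
  apply: leq_trans (dim_orthov _); apply: leq_ltn_trans (dim_span _) _.
  by rewrite sb.
have hu0 : hnorm u != 0.
  apply: contra_neq u0 => hu; apply: ip_eq0.
  by rewrite -hnormE hu expr0n rmorph0.
pose x := ofreal (hnorm u)^-1 *: u.
have xx : '[x, x] = 1.
  rewrite linearZl_LR linearZr_LR /= conj_ofreal -hnormE -!rmorphM /=.
  by rewrite expr2 mulKf// mulVf// rmorph1.
have xb v : v \in <<b>>%VS -> '[x, v] = 0.
  move: uo => /mem_orthovP uo /uo uv; by rewrite linearZl_LR /= uv mulr0.
exists (x :: b); split; first by rewrite /= sb.
- rewrite free_cons fb andbT; apply/negP => /xb/eqP.
  by rewrite xx oner_eq0.
- move: ob; rewrite /orthonormal /= xx eqxx andbT /= => /andP[-> ->].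
  by rewrite andbT; apply/allP => v vb /=; rewrite xb ?memv_span.
Qed.

End Facts.

(* Main.v *)
(* The operator that erases the block [{(j, i) | j}] from [theta_G theta_F^*]
   is, for [G = {nu_i pi_{V_i} e_j}], the i-th term of the fusion duality
   identity.  So every dual fusion frame of (W, w) yields a dual of F whose
   block erasure operators are its fusion terms, and a dual of F that is
   optimal for each block minimizes the maximum of the norms.

   If W is a Riesz fusion basis, then the sum of the W_i is direct, and
   [S_W (S_W^{-1} pi_i f) = pi_i f] gives
   [omega_j^2 pi_j S_W^{-1} pi_i = delta_{ij} pi_i].  Hence, for any dual G,
   only the i-th block contributes to [theta_G theta_F^*] at
   [omega_i^2 S_W^{-1} pi_i f], and it takes the same value at this vector as
   at f: the i-th block operator is [omega_i^2 S_W^{-1} pi_i], whatever G is. *)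
Require Import Defs.
From HB Require Import structures.
From mathcomp Require Import all_boot all_order all_algebra.
From mathcomp Require Import boolp classical_sets reals.
Import Order.TTheory GRing.Theory Num.Theory.
Local Open Scope ring_scope.

(** * Orthogonal projections and the fusion frame operator *)

Section FusionOperator.
Context {R : realType} {s : scalar_kind}.
Context {H : vectType (scal_field R s)} (ip : {dot H for @scal_conj R s}).
Local Notation "''[' u , v ]" := (ip u v).
Local Notation hnorm := (hnorm ip).
Local Notation proj := (proj ip).

Lemma sqr_hnorm_eq0 u : hnorm u ^+ 2 = 0 -> u = 0.
Proof. by move=> u0; apply: (@ip_eq0 _ _ _ ip); rewrite -hnormE u0 rmorph0. Qed.

Lemma proj_id (U : {vspace H}) u : u \in U -> proj U u = u.
Proof. exact/daddv_pi_id/orthov_cap. Qed.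

(** Since [a - proj U a] is orthogonal to [U], both sides equal the inner product of the two
    projections. *)
Lemma proj_adjoint U u v : '[proj U u, v] = '[u, proj U v].
Proof.
have cross a b : '[a - proj U a, proj U b] = 0.
  by have /mem_orthovP := sub_proj_orthov ip U a; apply; apply: proj_mem.
have projr a b : '[a, proj U b] = '[proj U a, proj U b].
  by rewrite -{1}(subrK (proj U a) a) linearDl /= cross add0r.
by rewrite projr ipC [RHS]ipC projr.
Qed.

Lemma frob_ge0 T : 0 <= frob ip T.
Proof.
by have [b /(frobE T) ->] := exists_onb ip; apply: sqrtr_ge0.
Qed.

Section Operator.
Context {m : nat} (W : 'I_m -> {vspace H}) (w : 'I_m -> R).
Local Notation S := (fusion_op ip W w).

Lemma fusion_opE u : S u = \sum_i ofreal (w i ^+ 2) *: proj (W i) u.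
Proof. by rewrite sum_lfunE; apply: eq_bigr => i _; rewrite scale_lfunE. Qed.

Lemma fusion_op_adjoint u v : '[S u, v] = '[u, S v].
Proof.
rewrite !fusion_opE linear_sumlz linear_sumr; apply: eq_bigr => i _ /=.
by rewrite linearZl_LR linearZr_LR /= conj_ofreal proj_adjoint.
Qed.

Hypothesis W_fusion : fusion_frame W w.

(** Pairing [S u = 0] with [u] gives a vanishing sum of the nonnegative terms
    [w i ^+ 2 * hnorm (proj (W i) u) ^+ 2]. So [u] is orthogonal to every [W i], hence to their sum,
    which contains [u]. *)
Lemma lker_fusion_op : lker S == 0%VS.
Proof.
have [w_gt0 W_total _] := W_fusion.
rewrite -subv0; apply/subvP => u; rewrite memv_ker memv0 => /eqP Su0.
have eq_u : \sum_i w i ^+ 2 * hnorm (proj (W i) u) ^+ 2 = 0.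
  apply: (can_inj (@ofrealK R s)); rewrite rmorph0 rmorph_sum /=.
  transitivity '[S u, u]; last by rewrite Su0 linear0l.
  rewrite fusion_opE linear_sumlz; apply: eq_bigr => i _ /=.
  by rewrite rmorphM hnormE linearZl_LR /= -proj_adjoint proj_id ?proj_mem.
have proj0 i : proj (W i) u = 0.
  apply: sqr_hnorm_eq0; apply/eqP.
  move/eqP: eq_u; rewrite psumr_eq0 => [/allP/(_ i)|j _]; last first.
    by rewrite mulr_ge0 ?sqr_ge0.
  by rewrite mem_index_enum mulf_eq0 expf_eq0 /= gt_eqF ?w_gt0 //=; apply.
have /memv_sumP[x xW xE] : u \in (\sum_i W i)%VS by rewrite W_total memvf.
apply/eqP/(@ip_eq0 _ _ _ ip); rewrite {2}xE linear_sumr big1 // => i _ /=.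
by rewrite -(proj_id _ _ (xW i isT)) -proj_adjoint proj0 linear0l.
Qed.

Lemma fusion_op_invK : cancel (S^-1)%VF S.
Proof. exact/lker0_lfunVK/lker_fusion_op. Qed.

Lemma fusion_op_inv_adjoint u v : '[(S^-1)%VF u, v] = '[u, (S^-1)%VF v].
Proof. by rewrite -{1}(fusion_op_invK v) -fusion_op_adjoint fusion_op_invK. Qed.

End Operator.

(** The lower Riesz bound over all indices forces the sum of the squared norms to be at most 0. *)
Lemma riesz_independent m (W : 'I_m -> {vspace H}) (u : 'I_m -> H) :
  riesz_fusion_basis ip W -> (forall i, u i \in W i) -> \sum_i u i = 0 ->
  forall i, u i = 0.
Proof.
move=> [_ [A [B [A_gt0 _ bound]]]] uW u0 i; apply: sqr_hnorm_eq0.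
have sumT (V : nmodType) (E : 'I_m -> V) :
    \sum_(j in [set: 'I_m]%SET) E j = \sum_j E j.
  by apply: eq_bigl => j; rewrite inE.
have [+ _] := bound [set: 'I_m]%SET u (fun j _ => uW j); rewrite !sumT.
have -> : hnorm (\sum_j u j) ^+ 2 = 0.
  by apply: (can_inj (@ofrealK R s)); rewrite hnormE u0 linear0l rmorph0.
rewrite pmulr_rle0 // => le0; apply/eqP; move: le0.
rewrite le_eqVlt ltNge sumr_ge0 => [|j _]; last exact: sqr_ge0.
rewrite orbF psumr_eq0 => [/allP/(_ i)|j _]; last exact: sqr_ge0.
by rewrite mem_index_enum; apply.
Qed.

Lemma erasure_opE (I : finType) (F G : I -> H) (L : {set I}) f :
  erasure_op ip F L G f = \sum_(k in L) '[f, F k] *: G k.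
Proof.
rewrite !comp_lfunE synthesisE [RHS]big_mkcond; apply: eq_bigr => k _.
by rewrite coord_projE analysisE; case: ifP; rewrite ?scale0r.
Qed.

(** * Splitting the erasure operators along index blocks *)

Section Blocks.
Context {n m : nat} (F : 'I_n * 'I_m -> H).
Local Notation block i := [set k : 'I_n * 'I_m | k.2 == i]%SET.

Lemma card_block i : #|block i| = n.
Proof.
have inj_i : injective (fun j : 'I_n => (j, i)) by move=> j j' [].
rewrite -[RHS](card_ord n) -(card_imset 'I_n inj_i).
apply: eq_card => -[j k]; rewrite !inE /=; apply/eqP/imsetP => [->|].
  by exists j.
by case=> j' _ [_ ->].
Qed.

Lemma block_erasure_opE G i f :
  erasure_op ip F (block i) G f = \sum_j '[f, F (j, i)] *: G (j, i).
Proof.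
rewrite erasure_opE (reindex_onto (pair^~ i) fst) => [|[j k]]; last first.
  by rewrite inE => /eqP /= ->.
by apply: eq_bigl => j; rewrite inE !eqxx.
Qed.

(** The blocks partition the index set, so duality says that the block operators add up to the
    identity. *)
Lemma sum_block_erasure_op G :
  \sum_i erasure_op ip F (block i) G = (synthesis G \o analysis ip F)%VF.
Proof.
apply/lfunP => f; rewrite sum_lfunE comp_lfunE synthesisE.
under eq_bigr do rewrite block_erasure_opE.
rewrite exchange_big pair_bigA; apply: eq_bigr => -[j i] _ /=.
by rewrite analysisE.
Qed.

End Blocks.

(** * The discrete frame attached to a fusion frame *)

Section CanonicalFrame.
Context {n m : nat} (e : n.-tuple H) (e_onb : is_onb ip e).
Context (W : 'I_m -> {vspace H}) (w : 'I_m -> R).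
Hypothesis W_fusion : fusion_frame W w.
Local Notation S := (fusion_op ip W w).
Local Notation block i := [set k : 'I_n * 'I_m | k.2 == i]%SET.
Let F (k : 'I_n * 'I_m) :=
  ofreal (w k.2) *: proj (W k.2) ((S^-1)%VF (tnth e k.1)).

(** Self-adjointness moves both operators onto [f]: up to the factor [w i], the coefficients of
    block [i] are the [e]-coordinates of a single vector, which depends on [f] only through
    [proj (W i) f]. *)
Lemma ip_canonical f j i :
  '[f, F (j, i)] = ofreal (w i) * '[(S^-1)%VF (proj (W i) f), tnth e j].
Proof.
rewrite linearZr_LR /= conj_ofreal -proj_adjoint.
by rewrite fusion_op_inv_adjoint.
Qed.

Lemma onb_expand_tnth u : u = \sum_j '[u, tnth e j] *: tnth e j.
Proof. by rewrite {1}(onb_expand u e_onb) big_tuple. Qed.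

Lemma block_erasure_op_fusion (V : 'I_m -> {vspace H}) (v : 'I_m -> R) i :
  erasure_op ip F (block i)
    (fun k => ofreal (v k.2) *: proj (V k.2) (tnth e k.1)) =
  fusion_term ip W w V v i.
Proof.
apply/lfunP => f; rewrite block_erasure_opE scale_lfunE !comp_lfunE /=.
rewrite [X in proj (V i) X]onb_expand_tnth linear_sum scaler_sumr.
apply: eq_bigr => j _; rewrite ip_canonical [in RHS]linearZ /= !scalerA rmorphM.
by rewrite mulrAC.
Qed.

Lemma dual_framesP (V : 'I_m -> {vspace H}) (v : 'I_m -> R) :
  dual_frames ip F (fun k => ofreal (v k.2) *: proj (V k.2) (tnth e k.1)) <->
  \sum_i fusion_term ip W w V v i = \1%VF.
Proof.
rewrite /dual_frames /= -sum_block_erasure_op.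
by rewrite (eq_bigr _ (fun i _ => block_erasure_op_fusion V v i)).
Qed.

Lemma block_optimal_one_loss V v :
  (forall i, 0 < v i) ->
  let G (k : 'I_n * 'I_m) := ofreal (v k.2) *: proj (V k.2) (tnth e k.1) in
  dual_frames ip F G ->
  (forall i, partial_optimal_dual_for ip F (block i) G) ->
  one_loss_optimal ip W w V v.
Proof.
move=> v_gt0 G dualG optG.
have dualV : dual_fusion_frames ip W w (V, v).
  by split=> //; apply/dual_framesP.
split=> //; apply/eqP; rewrite eq_le; apply/andP; split.
  (* Each competitor [(Z, z)] induces a dual of [F], so the optimality of [G] on every block bounds
     the maximum term by term. *)
  apply: lb_le_inf; first by exists (one_loss ip W w V v), (V, v).
  move=> _ [[Z z] [_ /dual_framesP dualZ] <-].
  apply: le_bigmax2 => i _; rewrite -!block_erasure_op_fusion.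
  have [_ ->] := optG i; apply: ge_inf; last by eexists; first exact: dualZ.
  by exists 0 => _ [X _ <-]; apply: frob_ge0.
apply: ge_inf; last by exists (V, v).
by exists 0 => _ [Zz _ <-]; apply: bigmax_ge_id.
Qed.

(** For fixed [i], the differences [d j] of the two sides lie in [W j] and sum to [S (S^-1 (proj (W
    i) f)) - proj (W i) f = 0], so independence kills each of them. *)
Lemma riesz_proj_biorthogonal i j f : riesz_fusion_basis ip W ->
  ofreal (w j ^+ 2) *: proj (W j) ((S^-1)%VF (proj (W i) f)) =
  if j == i then proj (W i) f else 0.
Proof.
move=> W_riesz; apply/eqP; rewrite -subr_eq0; apply/eqP; move: j.
pose d j := ofreal (w j ^+ 2) *: proj (W j) ((S^-1)%VF (proj (W i) f)) -
            (if j == i then proj (W i) f else 0).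
apply: (riesz_independent _ W d W_riesz) => [j|].
  apply: rpredB; first by rewrite memvZ ?proj_mem.
  by case: eqP => [->|_]; rewrite ?proj_mem ?mem0v.
rewrite sumrB -fusion_opE (fusion_op_invK W w W_fusion).
by rewrite -big_mkcond big_pred1_eq subrr.
Qed.

Lemma riesz_block_erasure_op G i : riesz_fusion_basis ip W ->
  dual_frames ip F G ->
  erasure_op ip F (block i) G =
    ofreal (w i ^+ 2) *: ((S^-1)%VF \o proj (W i))%VF.
Proof.
move=> W_riesz dualG; apply/lfunP => f; rewrite scale_lfunE [in RHS]comp_lfunE /=.
set g := _ *: _.
have projg j : proj (W j) g = if j == i then proj (W i) f else 0.
  rewrite -(riesz_proj_biorthogonal i j f W_riesz) linearZ /=.
  (* The weight is now [w i] on one side and [w j] on the other; for [j != i] the projection itself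
     vanishes, because [w j] is nonzero. *)
  have [-> //|/negPf ji] := eqVneq j i.
  have [w_gt0 _ _] := W_fusion.
  have /eqP := riesz_proj_biorthogonal i j f W_riesz.
  rewrite ji scaler_eq0 fmorph_eq0 expf_eq0 /= gt_eqF ?w_gt0 //=.
  by move=> /eqP ->; rewrite !scaler0.
have gE : (\sum_j erasure_op ip F (block j) G) g = g.
  by rewrite sum_block_erasure_op dualG lfunE.
(* Duality is applied at [g] rather than [f]. Block [j] sees its argument only through [proj (W j)],
   so the other blocks vanish at [g] and block [i] takes the same value at [g] as at [f]. *)
rewrite -[RHS]gE sum_lfunE (bigD1 i) //= [X in _ + X]big1 ?addr0 => [|j ji].
  rewrite !block_erasure_opE; apply: eq_bigr => j _.
  by rewrite !ip_canonical projg eqxx.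
rewrite block_erasure_opE big1 // => k _.
by rewrite ip_canonical projg (negPf ji) linear0 linear0l mulr0 scale0r.
Qed.

Lemma riesz_partial_optimal G : riesz_fusion_basis ip W ->
  dual_frames ip F G -> partial_optimal_dual ip F n G.
Proof.
(* Non-triviality of the fusion frame supplies an index [i], hence a block to erase. *)
move=> W_riesz dualG; have [_ _ [i _]] := W_fusion.
exists (block i); split; first exact: card_block.
(* All duals share the same block operator, so the infimum is over a singleton. *)
split=> //; rewrite -[LHS]inf1; congr inf; apply/seteqP; split=> x /=.
  by move=> ->; exists G.
by move=> [X dualX <-]; rewrite !riesz_block_erasure_op.
Qed.

End CanonicalFrame.

End FusionOperator.

Theorem theorem4p3 (R : realType) (s : scalar_kind)
    (H : vectType (scal_field R s)) (ip : {dot H for @scal_conj R s})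
    (n m : nat) (dimH : \dim {:H} = n)
    (W : 'I_m -> {vspace H}) (w : 'I_m -> R)
    (W_fusion : fusion_frame W w)
    (e : n.-tuple H) (e_onb : is_onb ip e) :
  let F := fun k : 'I_n * 'I_m =>
    ofreal (w k.2) *:
      proj ip (W k.2) ((fusion_op ip W w)^-1%VF (tnth e k.1)) in
  (forall (V : 'I_m -> {vspace H}) (v : 'I_m -> R),
     fusion_frame V v ->
     let G := fun k : 'I_n * 'I_m =>
       ofreal (v k.2) *: proj ip (V k.2) (tnth e k.1) in
     dual_frames ip F G ->
     (forall i : 'I_m,
        partial_optimal_dual_for ip F [set k | k.2 == i]%SET G) ->
     one_loss_optimal ip W w V v)
  /\
  (riesz_fusion_basis ip W ->
   forall G : 'I_n * 'I_m -> H,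
     dual_frames ip F G -> partial_optimal_dual ip F n G).
Proof.
move=> F; split=> [V v [v_gt0 _ _]|W_riesz G].
  exact: block_optimal_one_loss.
exact: riesz_partial_optimal.
Qed.
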